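(* Let $n\in\mathbb N_{>0}$, $p\ge 1$, let $(\Xi_k,\rho_k)$, $k\in\{1,\ldots,n\}$, be proper metric spaces, let $\Xi:=\Xi_1\times\cdots\times\Xi_n$, and let $\rho$ be a metric on $\Xi$ that makes $\Xi$ a Polish space and that is equivalent to the product metric $\big(\sum_{k=1}^n\rho_k^q\big)^{1/q}$ for some $q\in[1,+\infty]$. Let $\bm\varepsilon=(\varepsilon_1,\ldots,\varepsilon_n)$ with $\varepsilon_k\ge 0$ for all $k$. Then, for any reference measure $Q\in\mathcal P_p(\Xi)$, the multi-transport hyperrectangle $\mathcal T_p(Q,\bm\varepsilon)$ is weakly compact.
   Context: A metric space is proper if all its closed and bounded subsets are compact. Equivalence of $\rho$ and the product metric $\rho_{\rm prod}$ means that there are constants $0<c\le C$ with $c\,\rho_{\rm prod}\le\rho\le C\rho_{\rm prod}$ (for $q=\infty$ the product metric is $\max_k\rho_k$). $\mathcal P(\Xi)$ is the set of Borel probability measures on $\Xi$, and $\mathcal P_p(\Xi)$ is the subset of those with finite $p$th moment, i.e. $\int_\Xi\rho(\zeta,\xi)^p\,dP(\xi)<\infty$ for some $\zeta\in\Xi$. The multi-transport hyperrectangle (MTH) with reference distribution $Q$ and transport budgets $\bm\varepsilon$ is $$\mathcal T_p(Q,\bm\varepsilon):=\Big\{\mathrm{pr}_{2\#}\pi:\ \pi\in\mathcal P(\Xi\times\Xi),\ \mathrm{pr}_{1\#}\pi=Q,\ \int_{\Xi\times\Xi}\rho_k(\zeta_k,\xi_k)^p\,d\pi(\zeta,\xi)\le\varepsilon_k^p\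 \text{for all }k\in\{1,\ldots,n\}\Big\},$$ where $\mathrm{pr}_{1\#}\pi,\mathrm{pr}_{2\#}\pi$ are the first and second marginals of $\pi$, and $\zeta_k,\xi_k$ are the $k$th components of $\zeta,\xi\in\Xi$. The weak topology on (subsets of) $\mathcal P(\Xi)$ is the weakest topology making $P\mapsto\mathbb E_P[g]$ continuous for all bounded continuous $g:\Xi\to\mathbb R$. *)

(* Defs.v *)
From HB Require Import structures.
From mathcomp Require Import all_boot all_order all_algebra.
From mathcomp Require Import all_classical all_reals all_analysis.

Set Implicit Arguments.
Unset Strict Implicit.
Unset Printing Implicit Defensive.

Import Order.TTheory GRing.Theory Num.Theory.
Import numFieldNormedType.Exports.

Local Open Scope classical_set_scope.
Local Open Scope ring_scope.

(* Nonnegativity follows from the axioms. *)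
Record metric (R : realType) (T : Type) := MkMetric {
  metric_fun :> T -> T -> R ;
  metric_xx : forall x, metric_fun x x = 0 ;
  metric_positivity : forall x y, metric_fun x y = 0 -> x = y ;
  metric_symmetry : forall x y, metric_fun x y = metric_fun y x ;
  metric_triangular :
    forall y x z, metric_fun x z <= metric_fun x y + metric_fun y z
}.

(* The metric space (T, d), with the topology induced by d. The base point t0
   is recorded only because the library requires the carrier of a sigma-algebra
   to be pointed; it plays no other role. *)
Definition metrized (R : realType) (T : Type) (t0 : T) (d : metric R T) : Type :=
  T.

Section metrized_structures.
Context (R : realType) (T : Type) (t0 : T) (d : metric R T).
HB.instance Definition _ := gen_eqMixin (metrized t0 d).
HB.instance Definition _ := gen_choiceMixin (metrized t0 d).
HB.instance Definition _ := isPointed.Build (metrized t0 d) t0.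
HB.instance Definition _ := @isMetric.Build R (metrized t0 d) d
  (metric_xx d) (@metric_positivity _ _ d) (metric_symmetry d)
  (metric_triangular d).
End metrized_structures.

Definition proper_metric_space (R : realType) (T : metricType R) : Prop :=
  forall A : set T, closed A ->
    (exists M : R, forall x y, A x -> A y -> mdist x y <= M) -> compact A.

Definition complete_space (T : puniformType) : Prop :=
  forall F : set_system T, ProperFilter F -> cauchy F -> cvg F.

Definition separable_space (T : topologicalType) : Prop :=
  exists D : set T, countable D /\ dense D.

Definition completely_metrizable (R : realType) (T : ptopologicalType) : Prop :=
  exists d : metric R T,
    (forall A : set T, open A <-> open (A : set (metrized point d))) /\
    complete_space (metrized point d).

Definition polish_space (R : realType) (T : ptopologicalType) : Prop :=
  separable_space T /\ completely_metrizable R T.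

Section product_metric.
Context (R : realType) (n : nat) (Xi : 'I_n -> metricType R).

(* The value at q = -oo is irrelevant: q is always at least 1. *)
Definition product_dist (q : \bar R) (x y : forall k, Xi k) : R :=
  match q with
  | r%:E => (\sum_(k < n) mdist (x k) (y k) `^ r) `^ r^-1
  | +oo%E => \big[Num.max/0]_(k < n) mdist (x k) (y k)
  | -oo%E => 0
  end.

Definition equivalent_to_product_dist (rho : metric R (forall k, Xi k))
    (q : \bar R) : Prop :=
  exists c C : R, [/\ 0 < c, c <= C &
    forall x y, c * product_dist q x y <= rho x y <= C * product_dist q x y].

End product_metric.

HB.instance Definition _ (T1 T2 : ptopologicalType) :=
  Pointed.on (T1 * T2)%type.

Definition borel (T : ptopologicalType) := g_sigma_algebraType (@open T).

Section weak_topology.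
Context (R : realType) (T : ptopologicalType).

Definition bounded_continuous : Type :=
  {g : T -> R | continuous g /\ bounded_fun g}.

Definition mean (g : T -> R) (P : probability (borel T) R) : R :=
  fine ('E_P[g])%E.

(* Elements of [probability] are functions on all sets; measures that agree on
   the Borel sets but are distinct as functions are not separated by this
   topology. *)
Definition weak_probability : Type :=
  sup_topology (fun g : bounded_continuous =>
    Topological.class (initial_topology (mean (sval g)))).

HB.instance Definition _ := Topological.on weak_probability.

End weak_topology.

Section transport.
Context (R : realType) (n : nat) (Xi : 'I_n -> metricType R).
Context (xi0 : forall k, Xi k) (rho : metric R (forall k, Xi k)).

Local Notation X := (metrized xi0 rho).

Definition finite_moment (p : R) (P : probability (borel X) R) : Prop :=
  exists zeta : X, (\int[P]_xi (rho zeta xi `^ p)%:E < +oo)%E.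

(* Equality with a marginal is equality of Borel measures, i.e. on Borel sets.
   The sigma-algebra on X * X is the Borel one of the product topology. *)
Definition multi_transport_hyperrectangle (p : R) (Q : probability (borel X) R)
    (eps : 'I_n -> R) : set (probability (borel X) R) :=
  [set P | exists pi : probability (borel (X * X)%type) R,
    [/\ forall A, measurable A ->
          pushforward pi (fst : borel (X * X)%type -> borel X) A = Q A,
        forall A, measurable A ->
          pushforward pi (snd : borel (X * X)%type -> borel X) A = P A &
        forall k : 'I_n,
          (\int[pi]_z (mdist (z.1 k) (z.2 k) `^ p)%:E <= (eps k `^ p)%:E)%E]].

End transport.

(* Main.v *)
(* Let U be an ultrafilter of measures containing the hyperrectangle, and choose
   for each member P a coupling pi_P of Q and P within the budgets. The limit
   along U of the integrals of f against pi_P is a positive normalised linear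
   functional L of the bounded continuous functions f on X * X. The couplings
   are uniformly tight: their first marginal is Q, their transport costs are
   bounded, and bounded closed subsets of X are compact because the factors are
   proper. By Dini's argument, tightness makes L countably continuous enough for
   Daniell's construction, so L is the integral against a Borel probability pi.
   Its first marginal is Q, its costs respect the budgets by monotone
   convergence, and U converges weakly to its second marginal. *)

From HB Require Import structures.
From mathcomp Require Import all_boot all_order all_algebra.
From mathcomp Require Import all_classical all_reals all_analysis.
From mathcomp Require Import measurable_realfun ring lra.
Require Import Defs.

Set Implicit Arguments.
Unset Strict Implicit.
Unset Printing Implicit Defensive.

Import Order.TTheory GRing.Theory Num.Theory.
Import numFieldNormedType.Exports.

Local Open Scope classical_set_scope.
Local Open Scope ring_scope.

(** * Sets cut out by continuous functions, and images of ultrafilters *)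

Lemma open_gt_continuous (R : realType) (T : topologicalType) (f : T -> R)
  (c : R) : continuous f -> open [set z | c < f z].
Proof. by move=> /continuousP/(_ [set x | c < x]); apply; exact: open_gt. Qed.

Lemma closed_le_continuous (R : realType) (T : topologicalType) (f : T -> R)
  (c : R) : continuous f -> closed [set z | f z <= c].
Proof.
by move=> cf; apply: (@preimage_closed _ _ f [set x | x <= c]).
Qed.

Lemma ultra_fmap (T U : Type) (f : T -> U) (F : set_system T) :
  UltraFilter F -> UltraFilter (f @ F).
Proof.
move=> FU; split=> [|G GF FG]; first exact: fmap_proper_filter.
apply/seteqP; split=> A; last exact: FG.
move=> GA; have [//|FnA] := in_ultra_setVsetC (f @^-1` A) FU.
have GnA : G (~` A) by exact: FG.
by have := filter_not_empty G; rewrite -(setICr A); case; exact: filterI.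
Qed.

(** * The algebra of bounded continuous functions *)

Section bcts.
Context (R : realType) (Z : topologicalType).
Implicit Types f g : Z -> R.

Definition bcts f := continuous f /\ exists M : R, forall z, `|f z| <= M.

Lemma bcts_cst (c : R) : bcts (cst c).
Proof. by split; [move=> z; exact: cvg_cst|exists `|c|]. Qed.

Lemma bctsD f g : bcts f -> bcts g -> bcts (f \+ g).
Proof.
move=> [cf [M fM]] [cg [N gN]]; split.
  by move=> z; apply: cvgD; [exact: cf|exact: cg].
by exists (M + N) => z; rewrite (le_trans (ler_normD _ _))// lerD.
Qed.

Lemma bctsM f g : bcts f -> bcts g -> bcts (f \* g).
Proof.
move=> [cf [M fM]] [cg [N gN]]; split.
  by move=> z; apply: cvgM; [exact: cf|exact: cg].
by exists (M * N) => z; rewrite normrM ler_pM.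
Qed.

Lemma bctsZ (c : R) f : bcts f -> bcts (fun z => c * f z).
Proof. by move=> bf; exact: (bctsM (bcts_cst c) bf). Qed.

Lemma bctsB f g : bcts f -> bcts g -> bcts (f \- g).
Proof.
move=> bf bg; have := bctsD bf (bctsZ (-1) bg); congr bcts.
by apply/funext => z /=; rewrite mulN1r.
Qed.

Lemma bcts_sum (F : nat -> Z -> R) n :
  (forall i, bcts (F i)) -> bcts (fun z => \sum_(i < n) F i z).
Proof.
move=> bF; elim: n => [|n IHn].
  have := bcts_cst 0; congr bcts.
  by apply/funext => z; rewrite big_ord0.
have := bctsD IHn (bF n); congr bcts.
by apply/funext => z; rewrite big_ord_recr.
Qed.

Lemma bcts_min (c : R) f : 0 <= c -> continuous f -> (forall z, 0 <= f z) ->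
  bcts (fun z => Num.min c (f z)).
Proof.
move=> c0 cf f0; split=> [z|].
  by apply: (@continuous_min _ _ (cst c) f); [exact: cvg_cst|exact: cf].
by exists c => z; rewrite ger0_norm ?le_min ?c0 ?f0// ge_min lexx.
Qed.

End bcts.

(** * Borel measurability and cozero sets *)

Lemma measurable_borel_open (T : ptopologicalType) (A : set T) :
  open A -> measurable (A : set (borel T)).
Proof. by move=> oA; exact: sub_sigma_algebra. Qed.

Lemma measurable_borel_closed (T : ptopologicalType) (A : set T) :
  closed A -> measurable (A : set (borel T)).
Proof.
move=> clA; rewrite -[A]setCK; apply: measurableC.
by apply: measurable_borel_open; exact: closed_openC.
Qed.

Lemma measurable_borel_continuous (R : realType) (T : ptopologicalType)
  (f : T -> R) : continuous f -> measurable_fun setT (f : borel T -> R).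
Proof.
move=> /continuousP cf; apply: (measurability _ (RGenOpens.measurableE R)).
move=> _ [_ [a [b ->] <-]]; rewrite setTI; apply: measurable_borel_open.
by apply: cf; exact: interval_open.
Qed.

Lemma measurable_borel_comp (T U : ptopologicalType)
  (f : T -> U) : continuous f -> measurable_fun setT (f : borel T -> borel U).
Proof.
move=> /continuousP cf.
apply: (@measurability _ _ (borel T) (borel U) _ _ (@open U)) => //.
by move=> _ [A oA <-]; rewrite setTI; apply: measurable_borel_open; exact: cf.
Qed.

(* Equivalent to perfect normality. *)
Definition opens_are_cozero (R : realType) (T : topologicalType) : Prop :=
  forall G : set T, open G -> exists g : T -> R,
    [/\ continuous g, forall z, 0 <= g z & G = [set z | 0 < g z]].

(** The distance to the complement is positive exactly on [G]. Capping it at 1 keeps it finite,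
    since it is infinite when the complement is empty. *)
Lemma pseudometric_opens_are_cozero (R : realType) (T : pseudoMetricType R) :
  opens_are_cozero R T.
Proof.
move=> G oG; pose d := edist_inf (~` G).
have d0 z : (0 <= Order.min 1%E (d z))%E by rewrite le_min lee01 edist_inf_ge0.
have dfin z : Order.min 1%E (d z) \is a fin_num.
  by rewrite ge0_fin_numE// gt_min ltry.
exists (fun z => fine (Order.min 1%E (d z))); split.
- move=> z; apply: fine_cvg; rewrite fineK//.
  apply: (@min_fun_continuous _ _ _ (cst 1%E) d) => [?|].
    exact: cvg_cst.
  exact: edist_inf_continuous.
- by move=> z; exact: fine_ge0.
apply/seteqP; split=> z /=; last first.
  by apply: contraPP => Gz; rewrite /d edist_inf0// min_r ?lee01//= ltxx.
move=> Gz; rewrite -lte_fin fineK// lt_min lte01/=.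
have /nbhs_ballP[e /= e0 zeG] : nbhs z G by exact: open_nbhs_nbhs.
apply: (@lt_le_trans _ _ e%:E); first by rewrite lte_fin.
apply: le_ereal_inf_tmp => _ [a nGa <-].
rewrite leNgt; apply/negP => /edist_lt_ball.
by move/zeG; exact: nGa.
Qed.

(** * Means of bounded continuous functions *)

Section mean.
Context (R : realType) (Z : ptopologicalType).
Implicit Types (P : probability (borel Z) R) (f g : Z -> R).

Lemma bcts_integrable P f : bcts f -> P.-integrable setT (EFin \o f).
Proof.
move=> [cf [M fM]]; apply: (@le_integrable _ _ _ _ _ _ _ (EFin \o cst M)) => //.
- by apply/measurable_EFinP; exact: measurable_borel_continuous.
- move=> z _ /=; rewrite lee_fin (le_trans (fM z))// ler_norm//.
- by apply: finite_measure_integrable_cst.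
Qed.

Lemma meanE P f : bcts f -> (\int[P]_z (f z)%:E)%E = (mean f P)%:E.
Proof.
move=> bf; rewrite /mean unlock fineK//.
by apply: integrable_fin_num => //; exact: bcts_integrable.
Qed.

Lemma meanD P f g : bcts f -> bcts g -> mean (f \+ g) P = mean f P + mean g P.
Proof.
move=> bf bg; apply: EFin_inj; rewrite -meanE; last exact: bctsD.
rewrite EFinD -!meanE// -integralD//=; exact: bcts_integrable.
Qed.

Lemma mean_cst P (c : R) : mean (cst c) P = c.
Proof.
apply: EFin_inj; rewrite -meanE; last exact: bcts_cst.
by rewrite (integral_cst _ _ (c%:E))// [X in (_ * X)%E]probability_setT mule1.
Qed.

Lemma meanZ P (c : R) f : bcts f -> mean (fun z => c * f z) P = c * mean f P.
Proof.
move=> bf; apply: EFin_inj; rewrite -meanE; last exact: bctsZ.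
rewrite EFinM -!meanE// -integralZl//; exact: bcts_integrable.
Qed.

Lemma le_mean P f g : bcts f -> bcts g -> (forall z, f z <= g z) ->
  mean f P <= mean g P.
Proof.
move=> bf bg fg; rewrite -lee_fin -!meanE//.
apply: le_integral => //; [exact: bcts_integrable..|].
by move=> z _; rewrite lee_fin.
Qed.

(** Integrates [f <= c * \1_A]; the next lemma integrates the reverse bound, which is Markov's
    inequality. *)
Lemma mean_le_measure P f (c : R) (A : set Z) : bcts f -> 0 <= c ->
  measurable (A : set (borel Z)) -> (forall z, 0 <= f z <= c) ->
  (forall z, ~ A z -> f z = 0) -> ((mean f P)%:E <= c%:E * P A)%E.
Proof.
move=> bf c0 mA fc fA; rewrite -meanE//.
have -> : P A = (\int[P]_z (\1_A z)%:E)%E by rewrite integral_indic// setIT.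
rewrite -ge0_integralZl//=; last by apply/measurable_EFinP.
apply: ge0_le_integral => //.
- by move=> z _; rewrite lee_fin; case/andP: (fc z).
- by apply/measurable_EFinP; exact: measurable_borel_continuous bf.1.
- by apply/measurable_EFinP; exact: measurable_funM (measurable_cst _) _.
move=> z _; rewrite -EFinM lee_fin indicE.
have [/set_mem Az|/negP nAz] := boolP (z \in A).
  by rewrite mulr1; case/andP: (fc z).
by rewrite mulr0 fA// => /mem_set.
Qed.

Lemma mean_ge_measure P f (c : R) (A : set Z) : bcts f -> 0 <= c ->
  measurable (A : set (borel Z)) -> (forall z, 0 <= f z) ->
  (forall z, A z -> c <= f z) -> (c%:E * P A <= (mean f P)%:E)%E.
Proof.
move=> bf c0 mA f0 fA; rewrite -meanE//.
have -> : P A = (\int[P]_z (\1_A z)%:E)%E by rewrite integral_indic// setIT.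
rewrite -ge0_integralZl//=; last by apply/measurable_EFinP.
apply: ge0_le_integral => //.
- by move=> z _; rewrite mule_ge0// lee_fin.
- by apply/measurable_EFinP; exact: measurable_funM (measurable_cst _) _.
- by apply/measurable_EFinP; exact: measurable_borel_continuous bf.1.
move=> z _; rewrite -EFinM lee_fin indicE.
have [/set_mem Az|/negP nAz] := boolP (z \in A); first by rewrite mulr1 fA.
by rewrite mulr0.
Qed.

End mean.

(** * Daniell's construction of a probability from a positive functional *)

Section daniell.
Context (R : realType) (Z : ptopologicalType) (L : (Z -> R) -> R).
Hypothesis LD : forall f g, bcts f -> bcts g -> L (f \+ g) = L f + L g.
Hypothesis LZ : forall (c : R) f, bcts f -> L (fun z => c * f z) = c * L f.
Hypothesis le_L : forall f g, bcts f -> bcts g -> (forall z, f z <= g z) ->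
  L f <= L g.
Hypothesis L1 : L (cst 1) = 1.
(* The part of Daniell's continuity condition that prevents loss of mass. *)
Hypothesis L_cover1 : forall (f : nat -> Z -> R) c, (forall n, bcts (f n)) ->
  (forall n z, 0 <= f n z) -> (forall z, nondecreasing_seq (f ^~ z)) ->
  (forall z, exists n, 1 <= f n z) -> (forall n, L (f n) <= c) -> 1 <= c.
Hypothesis cozeroZ : opens_are_cozero R Z.

Let L0 : L (cst 0) = 0.
Proof.
rewrite -[RHS](mul0r (L (cst 0))) -LZ; last exact: bcts_cst.
by congr L; apply/funext => z; rewrite mul0r.
Qed.

Let L_ge0 f : bcts f -> (forall z, 0 <= f z) -> 0 <= L f.
Proof. by move=> bf f0; rewrite -L0; apply: le_L => //; exact: bcts_cst. Qed.

Let LB f g : bcts f -> bcts g -> L (f \- g) = L f - L g.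
Proof.
move=> bf bg; apply/eqP; rewrite eq_sym subr_eq -LD//; last exact: bctsB.
by apply/eqP; congr L; apply/funext => z /=; rewrite subrK.
Qed.

Let L_sum (F : nat -> Z -> R) n : (forall i, bcts (F i)) ->
  L (fun z => \sum_(i < n) F i z) = \sum_(i < n) L (F i).
Proof.
move=> bF; elim: n => [|n IHn].
  by rewrite big_ord0 -L0; congr L; apply/funext => z; rewrite big_ord0.
rewrite big_ord_recr/= -IHn -LD//; last exact: bcts_sum.
by congr L; apply/funext => z; rewrite big_ord_recr.
Qed.

(* Covering by an increasing sequence instead of a series makes the product of
   a cover with the increasing functions min(1, n g) again a cover, which gives
   the Caratheodory measurability of {g > 0} without double series. *)
Definition daniell_cover (A : set Z) : set R :=
  [set c | exists f : nat -> Z -> R, [/\ forall n, bcts (f n),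
    forall n z, 0 <= f n z, forall z, nondecreasing_seq (f ^~ z),
    forall z, A z -> exists n, 1 <= f n z & forall n, L (f n) <= c]].

Definition daniell_outer (A : set Z) : \bar R :=
  ereal_inf [set c%:E | c in daniell_cover A].

Let cover_ge0 A c : daniell_cover A c -> 0 <= c.
Proof.
by move=> [f [bf f0 _ _ /(_ 0%N)]]; apply: le_trans; exact: L_ge0.
Qed.

Let cover_cst A (f : Z -> R) : bcts f -> (forall z, 0 <= f z) ->
  (forall z, A z -> 1 <= f z) -> daniell_cover A (L f).
Proof.
move=> bf f0 Af; exists (fun=> f).
split => // [z m n _|z /Af fz]; first exact: lexx.
by exists 0%N.
Qed.

Let outer_le A c : daniell_cover A c -> (daniell_outer A <= c%:E)%E.
Proof. by move=> Ac; apply: ereal_inf_lbound; exists c. Qed.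

Let outer_ge0 A : (0 <= daniell_outer A)%E.
Proof.
by apply: le_ereal_inf_tmp => _ [c /cover_ge0 c0 <-]; rewrite lee_fin.
Qed.

Let outer_fin A : daniell_outer A \is a fin_num.
Proof.
rewrite ge0_fin_numE//; apply: (@le_lt_trans _ _ 1%:E); last exact: ltry.
by rewrite -L1; apply: outer_le; apply: cover_cst => //=; exact: bcts_cst.
Qed.

Let outer0 : daniell_outer set0 = 0%E.
Proof.
apply/eqP; rewrite eq_le outer_ge0 andbT; apply: outer_le.
by rewrite -L0; apply: cover_cst => //; exact: bcts_cst.
Qed.

Let le_outer : {homo daniell_outer : A B / A `<=` B >-> (A <= B)%E}.
Proof.
move=> A B AB; apply: le_ereal_inf_tmp => _ [c [f [bf f0 nf Bf fc]] <-].
by apply: outer_le; exists f; split => // z /AB; exact: Bf.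
Qed.

Let outer_approx A (e : R) : 0 < e ->
  exists2 c, daniell_cover A c & (c%:E <= daniell_outer A + e%:E)%E.
Proof.
move=> e0; have [_ [c Ac <-] ce] := lb_ereal_inf_adherent e0 (outer_fin A).
by exists c => //; exact: ltW.
Qed.

(** The diagonal partial sums [\sum_(i < n) f i n] of near-optimal covers [f i] of [A i] form an
    increasing sequence that covers the union, and each of its members is a finite sum, to which
    additivity of [L] applies. *)
Let outer_sigma : sigma_subadditive daniell_outer.
Proof.
move=> A; apply/lee_addgt0Pr => e e0.
(* The error [e] is distributed over the sets as [e / 2 ^ i.+1]. *)
apply: le_trans (epsilon_trick xpredT (fun=> outer_ge0 _) (ltW e0)).
set S := (X in (_ <= X)%E).
have /choice[c] : forall i, exists c : R, daniell_cover (A i) c /\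
    (c%:E <= daniell_outer (A i) + (e / (2 ^ i.+1)%:R)%:E)%E.
  move=> i; have [|c Ac ce] := @outer_approx (A i) (e / (2 ^ i.+1)%:R).
    by rewrite divr_gt0// ltr0n expn_gt0.
  by exists c.
move=> /all_and2[/choice[f]] /all_and5[bf f0 nf Af fc] cS.
have sumS n : ((\sum_(i < n) c i)%:E <= S)%E.
  apply: (@le_trans _ _ (\sum_(0 <= i < n)
      (daniell_outer (A i) + (e / (2 ^ i.+1)%:R)%:E))%E).
    by rewrite big_mkord -sumEFin; apply: lee_sum.
  apply: nneseries_lim_ge => i _ _; apply: adde_ge0 => //.
  by rewrite lee_fin divr_ge0// ltW.
have [Soo|] := eqVneq S +oo%E; first by rewrite Soo leey.
have S0 : (0 <= S)%E by have := sumS 0%N; rewrite big_ord0.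
rewrite -ltey -ge0_fin_numE// => Sfin.
rewrite -(fineK Sfin); apply: outer_le.
exists (fun n z => \sum_(i < n) f i n z); split.
- by move=> n; apply: (@bcts_sum _ _ (fun i => f i n)).
- by move=> n z; apply: sumr_ge0.
- move=> z; apply/nondecreasing_seqP => n; rewrite big_ord_recr/=.
  rewrite -[leLHS]addr0 lerD//; apply: ler_sum => i _.
  by apply: nf.
(* The successor makes the strict range [i < (maxn j n).+1] contain [j]. *)
- move=> z [j _] /Af[n fjn]; exists (maxn j n).+1.
  have jn : (j < (maxn j n).+1)%N by rewrite ltnS leq_maxl.
  rewrite (bigD1 (Ordinal jn))//= -[1]addr0 lerD ?sumr_ge0//.
  by apply: (le_trans fjn); apply: nf; rewrite leqW// leq_maxr.
- move=> n; rewrite (@L_sum (fun i => f i n))//.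
  rewrite -lee_fin fineK//; apply: le_trans (sumS n).
  by rewrite lee_fin; apply: ler_sum.
Qed.

HB.instance Definition _ := isOuterMeasure.Build R Z daniell_outer
  outer0 outer_ge0 le_outer outer_sigma.

(** A near-optimal cover [f] of [A] is split in two. The products of [f n] with [h n = min(1, n g)]
    cover the part of [A] in [{g > 0}], at cost [s]. For one fixed [m], the products of [f n] with
    [1 - h m] cover the rest, because [h m] vanishes where [g] does. Taking [m] with
    [L (f m \* h m)] within [e / 2] of [s] makes the two costs add up to at most [c + e / 2]. *)
Let outer_caratheodory_open G : open G -> daniell_outer.-caratheodory G.
Proof.
move=> /cozeroZ[g [cg g0 ->]].
apply: le_caratheodory_measurable => A.
apply/lee_addgt0Pr => e e0.
have e20 : 0 < e / 2 by rewrite divr_gt0.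
have [c [f [bf f0 nf Af fc]] cA] := @outer_approx A _ e20.
apply: (@le_trans _ _ (c%:E + (e / 2)%:E)%E); last first.
  by rewrite {2}[e]splitr EFinD addeA leeD2r.
pose h n z := Num.min 1 (n%:R * g z).
have bh n : bcts (h n).
  apply: bcts_min => // [|z]; last by rewrite mulr_ge0.
  by move=> z; apply: cvgM; [exact: cvg_cst|exact: cg].
have h0 n z : 0 <= h n z by rewrite le_min ler01 mulr_ge0.
have h1 n z : h n z <= 1 by rewrite ge_min lexx.
have nh z : nondecreasing_seq (h ^~ z).
  move=> m n mn; rewrite le_min ge_min lexx/= ge_min.
  by rewrite ler_wpM2r ?ler_nat ?orbT.
have hout n z : ~ 0 < g z -> h n z = 0.
  move=> /negP; rewrite -leNgt => gz.
  have gz0 : g z = 0 by apply/eqP; rewrite eq_le gz g0.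
  by rewrite /h gz0 mulr0 min_r.
pose F n z := f n z * h n z.
have bF n : bcts (F n) by exact: bctsM.
have FA : has_sup (range (L \o F)).
  split; first by exists (L (F 0%N)); exists 0%N.
  exists c => _ [n _ <-]; apply: le_trans (fc n); apply: le_L => // z.
  by rewrite /F ler_piMr.
pose s := sup (range (L \o F)).
have Fs n : L (F n) <= s by apply: sup_upper_bound => //; exists n.
have [_ [m _ <-] /= ms] := sup_adherent e20 FA.
have inA : daniell_cover (A `&` [set z | 0 < g z]) s.
  exists F; split => //.
  - by move=> n z; rewrite mulr_ge0.
  - by move=> z p q pq; apply: ler_pM => //; [exact: nf|exact: nh].
  - move=> z [/Af[n fn] /= gz].
    have [k hk] : exists k, h k z = 1.
      (* Beyond [1 / g z] the function [h k] attains the value 1 exactly at [z]. *)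
      exists (Num.bound (g z)^-1); rewrite /h min_l//.
      rewrite -ler_pdivrMr// mul1r ltW//; apply: le_lt_trans (archi_boundP _).
        exact: lexx.
      by rewrite invr_ge0.
    exists (maxn n k); rewrite /F -[1]mulr1; apply: ler_pM => //.
      by apply: (le_trans fn); apply: nf; rewrite leq_maxl.
    by rewrite -[leLHS]hk; apply: nh; rewrite leq_maxr.
have outA : daniell_cover (A `&` ~` [set z | 0 < g z]) (c - s + e / 2).
  pose h' z := 1 - h m z.
  have bh' : bcts h' by apply: (@bctsB _ _ (cst 1)) => //; exact: bcts_cst.
  have h'0 z : 0 <= h' z by rewrite subr_ge0.
  exists (fun n z => f n z * h' z); split.
  - by move=> n; apply: bctsM.
  - by move=> n z; rewrite mulr_ge0.
  - by move=> z p q pq; apply: ler_wpM2r => //; exact: nf.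
  - by move=> z [/Af[n fn] gz]; exists n; rewrite /h' hout// subr0 mulr1.
  - move=> n.
    (* [N] dominates [n], so that [f n <= f N], and also [m], so that [f m \* h m <= f N \* h m].
       Then [L (f N) <= c] bounds the difference. *)
    pose N := maxn n m.
    have le1 : L (fun z => f n z * h' z) <= L (f N \- (f N \* h m)).
      apply: le_L; [exact: bctsM|apply: bctsB => //; exact: bctsM|move=> z /=].
      have -> : f N z - f N z * h m z = f N z * h' z.
        by rewrite /h' mulrBr mulr1.
      by rewrite ler_wpM2r//; apply: nf; rewrite leq_maxl.
    have le2 : L (F m) <= L (f N \* h m).
      apply: le_L => // [|z]; first exact: bctsM.
      by apply: ler_wpM2r => //; apply: nf; rewrite leq_maxr.
    rewrite LB// in le1; last exact: bctsM.
    by have := fc N; rewrite -/s in ms; lra.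
apply: (@le_trans _ _ (s%:E + (c - s + e / 2)%:E)%E).
  by apply: leeD; exact: outer_le.
by rewrite -!EFinD lee_fin; lra.
Qed.

Let outer_caratheodory_borel (A : set (borel Z)) : measurable A ->
  daniell_outer.-caratheodory A.
Proof.
apply: smallest_sub; last exact: outer_caratheodory_open.
split; first exact: caratheodory_measurable_set0.
- by move=> B; rewrite setTD; exact: caratheodory_measurable_setC.
- exact: caratheodory_measurable_bigcup.
Qed.

(** The same function on the carrier [borel Z], so that the measure structure refers to the Borel
    sigma-algebra. *)
Definition daniell_measure : set (borel Z) -> \bar R := daniell_outer.

Let measure0 : daniell_measure set0 = 0%E. Proof. exact: outer0. Qed.

Let measure_ge0 A : (0 <= daniell_measure A)%E. Proof. exact: outer_ge0. Qed.

Let measure_sigma_additive : semi_sigma_additive daniell_measure.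
Proof.
move=> F mF tF mUF.
have := @caratheodory_measure_sigma_additive R Z daniell_outer F.
by apply; [move=> i| |]; [exact: outer_caratheodory_borel|
  exact: tF|exact: outer_caratheodory_borel].
Qed.

HB.instance Definition _ := isMeasure.Build _ (borel Z) R daniell_measure
  measure0 measure_ge0 measure_sigma_additive.

(** The constant cover 1 gives the upper bound; [L_cover1] says that no cover of the whole space
    costs less than 1. *)
Let measure_setT : daniell_measure setT = 1%E.
Proof.
apply/eqP; rewrite eq_le; apply/andP; split.
  by rewrite -L1; apply: outer_le; apply: cover_cst => //=; exact: bcts_cst.
apply: le_ereal_inf_tmp => _ [c [f [bf f0 nf fT fc]] <-].
by rewrite lee_fin; apply: (L_cover1 bf f0) => // z; exact: fT.
Qed.

HB.instance Definition _ := Measure_isProbability.Build _ (borel Z) R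
  daniell_measure measure_setT.

(* The layers [t n.+1 \- t n] of [f], of height [d], satisfy
   mean (t n.+2 \- t n.+1) <= d * P {f > (n+1) d} <= L (t n.+1 \- t n),
   and telescoping loses only the bottom layer. *)
Let mean_le f : bcts f -> (forall z, 0 <= f z) -> mean f daniell_measure <= L f.
Proof.
move=> bf f0; apply/ler_addgt0Pr => d d0.
pose t n z := Num.min (n%:R * d) (f z).
have bt n : bcts (t n).
  by apply: bcts_min => //; [rewrite mulr_ge0// ltW|exact: bf.1].
have t0 n z : 0 <= t n z by rewrite le_min f0 andbT mulr_ge0// ltW.
have tS n z : t n z <= t n.+1 z.
  by rewrite le_min !ge_min lexx orbT andbT ler_wpM2r ?ler_nat ?(ltW d0).
have tSd n z : t n.+1 z <= t n z + d.
  rewrite /t -natr1 mulrDl mul1r.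
  by rewrite addr_minl le_min !ge_min lexx/= lerDl (ltW d0) orbT.
have tSE n : t n.+1 = t n \+ (t n.+1 \- t n).
  by apply/funext => z /=; rewrite addrC subrK.
have {}mean_le n : mean (t n.+1) daniell_measure <= L (t n) + d.
  elim: n => [|n IHn].
    rewrite -[leLHS]add0r lerD//; first exact: L_ge0.
    rewrite -[leRHS](mean_cst daniell_measure); apply: le_mean => //=.
      exact: bcts_cst.
    by move=> z; rewrite /t mul1r ge_min lexx.
  rewrite tSE meanD//; last exact: bctsB.
  rewrite [t n.+1 in leRHS]tSE LD//; last exact: bctsB.
  suff : mean (t n.+2 \- t n.+1) daniell_measure <= L (t n.+1 \- t n).
    by rewrite addrAC; exact: lerD.
  pose G := [set z | n.+1%:R * d < f z].
  have oG : open G by exact: open_gt_continuous bf.1.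
  rewrite -lee_fin.
  apply: (@le_trans _ _ (d%:E * daniell_measure G)%E).
    apply: mean_le_measure.
    - exact: bctsB.
    - exact: ltW.
    - exact: measurable_borel_open.
    - by move=> z; rewrite /= subr_ge0 tS lerBlDl tSd.
    - move=> z /negP; rewrite -leNgt => Gz; rewrite /= /t !min_r ?subrr//.
      by apply: (le_trans Gz); rewrite ler_wpM2r ?ler_nat// ltW.
  (* Divided by [d], the lower layer is nonnegative and equals 1 on [G], so as a constant sequence
     it covers [G]. *)
  rewrite muleC -lee_pdivlMr// -EFinM; apply: outer_le.
  rewrite mulrC -LZ; last exact: bctsB.
  apply: cover_cst; first by apply: bctsZ; exact: bctsB.
    by move=> z; rewrite mulr_ge0 ?invr_ge0 ?(ltW d0)//= subr_ge0.
  move=> z; rewrite /G/= => Gz.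
  rewrite mulrC ler_pdivlMr// mul1r /t min_l ?(ltW Gz)// min_l.
    by rewrite -natr1 mulrDl mul1r addrAC subrr add0r.
  by apply: le_trans (ltW Gz); rewrite ler_wpM2r ?ler_nat// ltW.
have [M fM] := bf.2.
(* From this index on the truncation level exceeds the bound [M] of [f], so both sides of the
   estimate involve [f] itself. *)
pose n := Num.bound `|M / d|.
have tf m : (n <= m)%N -> t m = f.
  move=> nm; apply/funext => z; rewrite /t min_r//.
  rewrite (le_trans (ler_norm _))// (le_trans (fM z))// -ler_pdivrMr//.
  apply: (@le_trans _ _ n%:R); last by rewrite ler_nat.
  by apply: ltW; apply: (le_lt_trans (ler_norm _)); exact: archi_boundP.
by have := mean_le n; rewrite !tf.
Qed.

(** The inequality [mean_le] is one-sided and concerns nonnegative functions. Applied to [M + f] and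
    to [M - f], it gives both inequalities for [f]. *)
Lemma daniell_representation : exists P : probability (borel Z) R,
  forall f, bcts f -> mean f P = L f.
Proof.
exists daniell_measure => f bf; have [M fM] := bf.2.
have bM : bcts (cst M : Z -> R) by exact: bcts_cst.
have bN : bcts (fun z => -1 * f z) by exact: bctsZ.
have LM : L (cst M) = M.
  rewrite -[RHS]mulr1 -L1 -LZ; last exact: bcts_cst.
  by congr L; apply/funext => z; rewrite mulr1.
pose g z := -1 * f z.
have : mean (f \+ cst M) daniell_measure <= L (f \+ cst M).
  apply: mean_le => [|z /=]; first exact: bctsD.
  by have := fM z; rewrite ler_norml; lra.
have : mean (g \+ cst M) daniell_measure <= L (g \+ cst M).
  apply: mean_le => [|z /=]; first exact: bctsD.
  by have := fM z; rewrite /g ler_norml; lra.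
rewrite !meanD// !LD// mean_cst LM meanZ// LZ//.
by move=> ? ?; apply/eqP; rewrite eq_le; lra.
Qed.

End daniell.

(** * Dini's argument and Prokhorov's theorem along an ultrafilter *)

(** The open sets [{c < f n}] increase with [n] and cover [K], so by compactness one of them
    contains [K]. *)
Lemma nondecreasing_cover_compact (R : realType) (Z : topologicalType)
    (K : set Z) (f : nat -> Z -> R) (c : R) : compact K ->
  (forall n, continuous (f n)) -> (forall z, nondecreasing_seq (f ^~ z)) ->
  (forall z, K z -> exists n, c < f n z) ->
  exists n, forall z, K z -> c < f n z.
Proof.
move=> /compact_near_coveringP Kc cf nf Kf.
have [N _ NK] : \forall n \near \oo, K `<=` [set z | c < f n z].
  apply: Kc => z /Kf[n fnz].
  exists ([set y | c < f n y], [set m | (n <= m)%N]).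
    split; last exact: nbhs_infty_ge.
    by apply: open_nbhs_nbhs; split => //; exact: open_gt_continuous.
  by move=> [y m] [/= fny nm]; apply: (lt_le_trans fny); exact: nf.
by exists N => z; apply: (NK N) => /=.
Qed.

Section prokhorov.
Context (R : realType) (Z : ptopologicalType) (I : Type) (U : set_system I).
Context (P : I -> probability (borel Z) R).
Hypothesis UU : UltraFilter U.
Hypothesis cozeroZ : opens_are_cozero R Z.
Hypothesis P_tight : forall e : R, 0 < e -> exists K : set Z,
  [/\ compact K, measurable (K : set (borel Z)) &
      \forall i \near U, ((1 - e)%:E <= P i K)%E].

Let L f : R := lim (mean f (P i) @[i --> U]).

(** The means lie in the compact interval [[- M, M]], where every ultrafilter converges. *)
Let mean_cvg f : bcts f -> mean f (P i) @[i --> U] --> L f.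
Proof.
move=> bf; have [M fM] := bf.2.
have [l [_ cvf]] : `[- M, M] `&`
    [set p : R | mean f (P i) @[i --> U] --> p] !=set0.
  have := @segment_compact R (- M) M; rewrite compact_ultra; apply.
    exact: ultra_fmap.
  apply: (@filterE _ U) => i /=; rewrite in_itv/=; apply/andP; split.
    rewrite -(mean_cst (P i) (- M)); apply: le_mean => //; first exact: bcts_cst.
    by move=> z; have := fM z; rewrite ler_norml => /andP[].
  rewrite -(mean_cst (P i) M); apply: le_mean => //; first exact: bcts_cst.
  by move=> z; have := fM z; rewrite ler_norml => /andP[].
by apply/cvg_ex; exists l.
Qed.

Let L_eq f l : mean f (P i) @[i --> U] --> l -> L f = l.
Proof. by move=> cvf; apply/cvg_lim. Qed.

Let L_ge f (c : R) : bcts f -> (\forall i \near U, c <= mean f (P i)) -> c <= L f.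
Proof.
move=> bf cf; apply: limr_ge => //; apply/cvg_ex.
by exists (L f); exact: mean_cvg.
Qed.

Let L_D f g : bcts f -> bcts g -> L (f \+ g) = L f + L g.
Proof.
move=> bf bg; apply: L_eq; under eq_fun do rewrite meanD//.
by apply: cvgD; exact: mean_cvg.
Qed.

Let L_Z (c : R) f : bcts f -> L (fun z => c * f z) = c * L f.
Proof.
move=> bf; apply: L_eq; under eq_fun do rewrite meanZ//.
by apply: cvgMr; exact: mean_cvg.
Qed.

Let le_L f g : bcts f -> bcts g -> (forall z, f z <= g z) -> L f <= L g.
Proof.
move=> bf bg fg; rewrite -subr_ge0.
have -> : L g - L f = L (g \+ (fun z => -1 * f z)).
  by rewrite L_D// ?L_Z ?mulN1r//; exact: bctsZ.
have bgf : bcts (g \+ (fun z => -1 * f z)) by apply: bctsD => //; exact: bctsZ.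
apply: L_ge => //; apply: filterE => i.
rewrite -(mean_cst (P i) 0); apply: le_mean => // [|z]; first exact: bcts_cst.
by rewrite /= mulN1r subr_ge0.
Qed.

(** By Dini's argument some [f n] exceeds [1 - d] on a compact set of mass at least [1 - d] for
    eventually all [P i], whence [L (f n)] is at least [(1 - d) ^ 2]. *)
Let L_cover1 (f : nat -> Z -> R) c : (forall n, bcts (f n)) ->
  (forall n z, 0 <= f n z) -> (forall z, nondecreasing_seq (f ^~ z)) ->
  (forall z, exists n, 1 <= f n z) -> (forall n, L (f n) <= c) -> 1 <= c.
Proof.
move=> bf f0 nf f1 fc; apply/ler_addgt0Pr => e e0.
(* With [d <= e / 2], [(1 - d) ^ 2 >= 1 - 2 d >= 1 - e]; with [d <= 1 / 2], [1 - d] is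
   nonnegative. *)
pose d := Num.min (e / 2) (1 / 2).
have d0 : 0 < d by rewrite lt_min !divr_gt0.
have de : d <= e / 2 by rewrite ge_min lexx.
have d2 : d <= 1 / 2 by rewrite ge_min lexx orbT.
have [K [cK mK PK]] := P_tight d0.
have [n fnK] : exists n, forall z, K z -> 1 - d < f n z.
  apply: nondecreasing_cover_compact => // [m|z _]; first exact: (bf m).1.
  by have [m fm] := f1 z; exists m; apply: lt_le_trans fm; rewrite ltrBlDr ltrDl.
suff : (1 - d) * (1 - d) <= L (f n) by have := fc n; nra.
apply: L_ge => //; apply: filterS PK => i PiK.
have d1 : 0 <= 1 - d by lra.
rewrite -lee_fin; apply: le_trans (mean_ge_measure (P i) (bf n) d1 mK _ _) => //.
  by rewrite EFinM; apply: lee_wpmul2l; rewrite ?lee_fin.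
by move=> z /fnK/ltW.
Qed.

Lemma prokhorov_ultra : exists P0 : probability (borel Z) R,
  forall f, bcts f -> mean f (P i) @[i --> U] --> mean f P0.
Proof.
have L1 : L (cst 1) = 1.
  by apply: L_eq; under eq_fun do rewrite mean_cst; exact: cvg_cst.
have [P0 P0E] := daniell_representation L_D L_Z le_L L1 L_cover1 cozeroZ.
by exists P0 => f bf; rewrite P0E//; exact: mean_cvg.
Qed.

End prokhorov.

(** * Borel probabilities determined by means, push-forwards and truncation *)

Section borel_probability.
Context (R : realType).

(** The function [h = min(1, (n + 1) g)] lies between the indicators of [F n = {g > 1 / (n + 1)}]
    and of [{g > 0}], so the [P]-mass of [F n] is at most the [Q]-mass of [{g > 0}]. The sets [F n]
    increase to [{g > 0}]. *)
Lemma le_open_measure (T : ptopologicalType) (P Q : probability (borel T) R)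
    (g : T -> R) : continuous g -> (forall z, 0 <= g z) ->
  (forall f, bcts f -> mean f P = mean f Q) ->
  (P [set z | (0 < g z)%R] <= Q [set z | (0 < g z)%R])%E.
Proof.
move=> cg g0 PQ; pose F n := [set z | n.+1%:R^-1 < g z].
have oF n : open (F n) by exact: open_gt_continuous.
have mG : measurable ([set z | 0 < g z] : set (borel T)).
  by apply: measurable_borel_open; exact: open_gt_continuous.
have GF : [set z | 0 < g z] = \bigcup_n F n.
  apply/seteqP; split=> z /=.
    by move=> /ltr_add_invr[n]; rewrite add0r => gz; exists n.
  by move=> [n _]; apply: lt_trans; rewrite invr_gt0.
have cvF : P (F n) @[n --> \oo] --> P [set z | 0 < g z].
  rewrite GF; apply: nondecreasing_cvg_mu.
  - by move=> n; exact: measurable_borel_open.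
  - by rewrite -GF.
  - move=> m n mn; apply/subsetPset => z; apply: le_lt_trans.
    by rewrite lef_pV2 ?posrE// ler_nat ltnS.
apply: (cvge_to_le cvF); apply: nearW => n.
pose h z := Num.min 1 (n.+1%:R * g z).
have bh : bcts h.
  apply: bcts_min => // z; last by rewrite mulr_ge0.
  by apply: cvgM; [exact: cvg_cst|exact: cg].
have h0 z : 0 <= h z by rewrite le_min ler01 mulr_ge0.
apply: (@le_trans _ _ (mean h P)%:E).
  rewrite -[leLHS]mul1e; apply: mean_ge_measure => //.
    exact: measurable_borel_open.
  move=> z; rewrite /F/= => Fz; rewrite le_min lexx/=.
  by rewrite -ler_pdivrMl// mulr1 ltW.
rewrite PQ// -[leRHS]mul1e; apply: mean_le_measure => //.
  by move=> z; rewrite h0 ge_min lexx.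
move=> z /negP; rewrite -leNgt => gz.
have gz0 : g z = 0 by apply/eqP; rewrite eq_le gz g0.
by rewrite /h gz0 mulr0 min_r.
Qed.

(** Both measures agree on cozero sets, that is on open sets, and these form a generating family
    stable under intersection. *)
Lemma borel_probability_unique (T : ptopologicalType)
    (P Q : probability (borel T) R) :
  opens_are_cozero R T -> (forall f, bcts f -> mean f P = mean f Q) ->
  forall A : set (borel T), measurable A -> P A = Q A.
Proof.
move=> cozeroT PQ A mA.
apply: (@measure_unique _ _ (borel T) (@open T) (fun=> setT)) => //.
- exact: openI.
- by move=> _; exact: openT.
- by rewrite bigcup_const//; exists 0%N.
- move=> G /cozeroT[g [cg g0 ->]]; apply/eqP; rewrite eq_le.
  by rewrite !le_open_measure// => f /PQ.
- move=> _; apply: (@le_lt_trans _ _ 1%E); last exact: ltry.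
  exact: probability_le1.
Qed.

(** Change of variables. [Q] has to match the image of [P] on Borel sets only, which is the form in
    which the hyperrectangle prescribes marginals. *)
Lemma mean_pushforward (T U : ptopologicalType) (phi : T -> U)
    (P : probability (borel T) R) (Q : probability (borel U) R) (g : U -> R) :
  continuous phi ->
  (forall A : set (borel U), measurable A -> P (phi @^-1` A) = Q A) ->
  bcts g -> mean g Q = mean (g \o phi) P.
Proof.
move=> cphi PQ bg.
have bgp : bcts (g \o phi).
  split; first by move=> z; apply: continuous_comp; [exact: cphi|exact: bg.1].
  by have [M gM] := bg.2; exists M => z; exact: gM.
have mphi := measurable_borel_comp cphi.
apply: EFin_inj; rewrite -!meanE//.
transitivity (\int[pushforward P (phi : borel T -> borel U)]_z (g z)%:E)%E.
  by apply: eq_measure_integral => A mA _; exact: esym (PQ A mA).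
rewrite integral_pushforward//.
  by apply/measurable_EFinP; exact: measurable_borel_continuous bg.1.
exact: bcts_integrable.
Qed.

Lemma continuous_pushforward (T U : ptopologicalType) (phi : T -> U)
    (P : probability (borel T) R) : continuous phi ->
  exists Q : probability (borel U) R,
    forall A : set (borel U), P (phi @^-1` A) = Q A.
Proof.
move=> cphi.
pose f : {mfun borel T >-> borel U} := HB.pack (phi : borel T -> borel U)
  (@isMeasurableFun.Build _ _ _ _ _ (measurable_borel_comp cphi)).
by exists (distribution P f).
Qed.

(** Weak limits control bounded functions only; monotone convergence carries a bound on all
    truncations over to an unbounded cost. *)
Lemma le_integral_truncated (T : ptopologicalType)
    (P : probability (borel T) R) (f : T -> R) (b : R) :
  continuous f -> (forall z, 0 <= f z) ->
  (forall n : nat, mean (fun z => Num.min n%:R (f z)) P <= b) ->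
  (\int[P]_z (f z)%:E <= b%:E)%E.
Proof.
move=> cf f0 fb.
pose g n z := (Num.min n%:R (f z))%:E.
have bg n : bcts (fun z => Num.min n%:R (f z)) by exact: bcts_min.
have ndg z : {homo g^~ z : m n / (m <= n)%N >-> (m <= n)%E}.
  move=> m n mn; rewrite lee_fin le_min ge_min ge_min lexx orbT andbT.
  by rewrite ler_nat mn.
have gE : (fun z => limn (g ^~ z)) = EFin \o f.
  apply/funext => z; apply/cvg_lim => //; apply: cvg_near_cst.
  near=> n; rewrite /g min_r//.
  by near: n; exact: nbhs_infty_ger.
have mg n : measurable_fun setT (g n : borel T -> \bar R).
  by apply/measurable_EFinP; exact: measurable_borel_continuous (bg n).1.
have g0 n z : setT z -> (0 <= g n z)%E by rewrite lee_fin le_min f0 ler0n.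
have := @cvg_monotone_convergence _ _ _ P _ measurableT g mg g0
  (fun z _ => ndg z).
rewrite gE => /cvge_to_le; apply; apply: nearW => n.
by rewrite /g meanE// lee_fin.
Unshelve. all: by end_near. Qed.

End borel_probability.

(** * Continuity of powers and distances, product distances, compact balls *)

(** Where [f] is positive, the power function is differentiable. At a zero of [f], the bound
    [f t < e ^ (1 / p)] gives [f t ^ p < e]. *)
Lemma continuous_powR (R : realType) (T : topologicalType) (f : T -> R)
    (p : R) : 0 < p -> continuous f -> (forall z, 0 <= f z) ->
  continuous (fun z => f z `^ p).
Proof.
move=> p0 cf f0 z; have [fz|fz] := ltP 0 (f z).
  apply: (@continuous_comp _ _ _ f (fun x : R => x `^ p)); first exact: cf.
  apply/differentiable_continuous/derivable1_diffP.
  by apply: derivable_powR; rewrite in_itv/= fz.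
have {}fz : f z = 0 by apply/eqP; rewrite eq_le fz f0.
apply/cvgrPdist_lt => e e0; rewrite fz powR0 ?gt_eqF//.
have : \forall t \near z, `|f z - f t| < e `^ p^-1.
  by have /cvgrPdist_lt := cf z; apply; exact: powR_gt0.
apply: filterS => t; rewrite fz !sub0r !normrN !ger0_norm ?powR_ge0// => ft.
have -> : e = (e `^ p^-1) `^ p.
  by rewrite -powRrM mulVf ?gt_eqF// powRr1// ltW.
by apply: gt0_ltr_powR => //; rewrite nnegrE ?powR_ge0.
Qed.

Section product_dist.
Context (R : realType) (n : nat) (Xi : 'I_n -> metricType R).
Implicit Types (x y : forall k, Xi k) (q : \bar R).

Lemma le_product_dist q x y k : (1 <= q)%E ->
  mdist (x k) (y k) <= product_dist q x y.
Proof.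
case: q => [r| |//]; last by move=> _; exact: le_bigmax.
rewrite lee_fin => r1 /=; have r0 : 0 < r by exact: lt_le_trans r1.
rewrite -[leLHS]powRr1 ?mdist_ge0// -(mulfV (lt0r_neq0 r0)) powRrM.
apply: ge0_ler_powR; rewrite ?invr_ge0 ?nnegrE ?powR_ge0 ?(ltW r0)//.
  by apply: sumr_ge0 => i _; exact: powR_ge0.
by rewrite (bigD1 k)//= lerDl; apply: sumr_ge0 => i _; exact: powR_ge0.
Qed.

Lemma product_dist_le q x y (d : R) : (0 < n)%N -> (1 <= q)%E -> 0 <= d ->
  (forall k, mdist (x k) (y k) <= d) -> product_dist q x y <= n%:R * d.
Proof.
move=> n0 q1 d0 xyd; have n1 : 1 <= n%:R :> R by rewrite ler1n.
case: q q1 => [r| |//]; last first.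
  move=> _; apply: bigmax_le => [|k _]; first by rewrite mulr_ge0.
  by rewrite (le_trans (xyd k))// ler_peMl.
rewrite lee_fin => r1 /=; have r0 : 0 < r by exact: lt_le_trans r1.
have nd0 : 0 <= n%:R * d by rewrite mulr_ge0.
rewrite -[leRHS]powRr1// -[X in _ <= _ `^ X](mulfV (lt0r_neq0 r0)) powRrM.
apply: ge0_ler_powR; rewrite ?invr_ge0 ?nnegrE ?powR_ge0 ?(ltW r0)//.
  by apply: sumr_ge0 => i _; exact: powR_ge0.
apply: (@le_trans _ _ (\sum_(k < n) d `^ r)).
  apply: ler_sum => k _.
  by apply: ge0_ler_powR; rewrite ?nnegrE ?mdist_ge0 ?(ltW r0).
(* The sum is [n d ^ r <= (n d) ^ r], because [n <= n ^ r] for [n, r >= 1]. This gives the factor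
   [n] for every exponent. *)
rewrite sumr_const card_ord -[leLHS]mulr_natl powRM//.
rewrite ler_wpM2r ?powR_ge0// -[leLHS]powRr1//.
exact: (ler_powR n1 r1).
Qed.

End product_dist.

Lemma continuous_mdist (R : realType) (T : topologicalType) (M : metricType R)
  (f g : T -> M) : continuous f -> continuous g ->
  continuous (fun z => mdist (f z) (g z)).
Proof.
move=> cf cg z; apply/cvgrPdist_lt => e e0.
have e2 : 0 < e / 2 by rewrite divr_gt0.
have near_ball (h : T -> M) : continuous h ->
    \forall t \near z, mdist (h z) (h t) < e / 2.
  move=> ch.
  have : \forall t \near z, ball (h z) (e / 2) (h t).
    exact: ch z _ (nbhsx_ballx (h z) _ e2).
  by apply: filterS => t; rewrite ballEmdist.
near=> t.
have ft : mdist (f z) (f t) < e / 2 by near: t; exact: near_ball.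
have gt : mdist (g z) (g t) < e / 2 by near: t; exact: near_ball.
(* These four inequalities bound the change of the distance by [mdist (f z) (f t) + mdist (g z) (g
   t) < e], in both directions. *)
have := metric_triangle (f z) (f t) (g z).
have := metric_triangle (f t) (g t) (g z).
have := metric_triangle (f t) (f z) (g t).
have := metric_triangle (f z) (g z) (g t).
rewrite (metric_sym (g t) (g z)) (metric_sym (f t) (f z)) ltr_norml.
by move=> *; apply/andP; split; lra.
Unshelve. all: by end_near. Qed.

Lemma ultra_cvg_compact (T : topologicalType) (K : set T) (F : set_system T) :
  compact K -> UltraFilter F -> F K -> exists2 p, K p & F --> p.
Proof.
rewrite compact_ultra => /(_ F) cK UF FK.
by have [p [Kp Fp]] := cK UF FK; exists p.
Qed.

Lemma closed_mdist_le (R : realType) (T : topologicalType) (M : metricType R)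
    (x : M) (f : T -> M) (r : R) :
  continuous f -> closed [set z | mdist x (f z) <= r].
Proof.
move=> cf; have cd : continuous (fun z => mdist x (f z)).
  by apply: (@continuous_mdist _ _ _ (cst x) f _ cf); exact: cst_continuous.
exact: closed_le_continuous.
Qed.

Lemma proper_closed_ball_compact (R : realType) (M : metricType R) (x : M)
    (r : R) : proper_metric_space M -> compact [set y | mdist x y <= r].
Proof.
apply; first by apply: (@closed_mdist_le _ _ _ x id) => ?; exact: cvg_id.
exists (r + r) => y z /= xy xz.
by rewrite (le_trans (metric_triangle _ x _))// lerD// metric_sym.
Qed.

(** * Convergence and compactness for the metric [rho] *)

Section equivalent_metric.
Context (R : realType) (n : nat) (hn : (0 < n)%N) (Xi : 'I_n -> metricType R).
Context (xi0 : forall k, Xi k) (rho : metric R (forall k, Xi k)).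
Hypothesis hrho : exists q : \bar R,
  (1 <= q)%E /\ equivalent_to_product_dist rho q.

Local Notation X := (metrized xi0 rho).

(** This bound and the next turn the equivalence of metrics into coordinatewise estimates in which
    [q] no longer appears. *)
Lemma coord_le_metric : exists2 c : R, 0 < c &
  forall (x y : X) k, mdist (x k) (y k) <= c * rho x y.
Proof.
have [q [q1 [c [C [c0 _ h]]]]] := hrho.
exists c^-1 => [|x y k]; first by rewrite invr_gt0.
rewrite ler_pdivlMl//; have /andP[+ _] := h x y; apply: le_trans.
by rewrite ler_pM2l//; exact: le_product_dist.
Qed.

Lemma metric_le_coord : exists2 C : R, 0 < C &
  forall (x y : X) d, 0 <= d -> (forall k, mdist (x k) (y k) <= d) ->
  rho x y <= C * d.
Proof.
have [q [q1 [c [C [c0 cC h]]]]] := hrho.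
have C0 : 0 < C by exact: lt_le_trans cC.
exists (C * n%:R) => [|x y d d0 xyd]; first by rewrite mulr_gt0// ltr0n.
have /andP[_ /le_trans] := h x y; apply; rewrite -mulrA ler_pM2l//.
exact: product_dist_le.
Qed.

Lemma continuous_coord k : continuous (fun x : X => x k : Xi k).
Proof.
have [c c0 hc] := coord_le_metric.
move=> x A /nbhs_ballP[e /= e0 eA].
suff : nbhs (x : X) ((fun y : X => y k : Xi k) @^-1` A) by [].
apply/nbhs_ballP; exists (e / c) => /=; first by rewrite divr_gt0.
move=> y; rewrite ballEmdist/= => xy; apply: eA; rewrite ballEmdist/=.
by rewrite (le_lt_trans (hc x y k))// mulrC -ltr_pdivlMr.
Qed.

Hypothesis hXi : forall k, proper_metric_space (Xi k).

(** Each coordinate of [F] is an ultrafilter on a closed ball, compact by properness, and so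
    converges. As there are finitely many coordinates, the limits assemble into a limit for
    [rho]. *)
Lemma bounded_ultra_cvg (F : set_system X) (M : R) : UltraFilter F ->
  F [set x | forall k, mdist (xi0 k) (x k) <= M] -> exists x : X, F --> x.
Proof.
move=> UF FM.
have /(_ _)/cid-/all_sig[l cvl] : forall k,
    exists y : Xi k, (fun x : X => x k) @ F --> y.
  move=> k.
  have [|y _ Fy] := @ultra_cvg_compact _ _ ((fun x : X => x k) @ F)
      (@proper_closed_ball_compact _ _ (xi0 k) M (@hXi k)) (ultra_fmap _ UF).
    by apply: (@filterS _ F _ _ _ _ FM) => x; exact.
  by exists y.
have [C C0 hC] := metric_le_coord.
exists l; apply/cvg_ballP => e e0.
(* The factor 2 recovers a strict inequality from the weak one of [metric_le_coord]. *)
have eC0 : 0 < e / C / 2 by rewrite !divr_gt0.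
have : \forall x \near F, forall k, mdist (l k) (x k) < e / C / 2.
  apply: filter_forall => k.
  have /cvg_ballP/(_ _ eC0) := cvl k.
  by apply: filterS => x; rewrite ballEmdist.
apply: filterS => x lx; rewrite ballEmdist/=.
apply: (@le_lt_trans _ _ (C * (e / C / 2))).
  by apply: hC => [|k]; apply: ltW.
rewrite mulrA mulrCA mulfV ?gt_eqF// mulr1. lra.
Qed.

Lemma bounded_closed_compact (K : set (X * X)) (M : R) : closed K ->
  (forall z, K z -> forall k,
    mdist (xi0 k) (z.1 k) <= M /\ mdist (xi0 k) (z.2 k) <= M) ->
  compact K.
Proof.
move=> Kcl KM; rewrite compact_ultra => F UF FK.
have [a Fa] : exists a : X, fst @ F --> a.
  apply: (@bounded_ultra_cvg _ M); first exact: ultra_fmap.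
  by apply: (@filterS _ F _ _ _ _ FK) => z /KM zM k; have [] := zM k.
have [b Fb] : exists b : X, snd @ F --> b.
  apply: (@bounded_ultra_cvg _ M); first exact: ultra_fmap.
  by apply: (@filterS _ F _ _ _ _ FK) => z /KM zM k; have [] := zM k.
have Fab : F --> (a, b).
  move=> A [[B1 B2] /= [/Fa FB1 /Fb FB2] BA].
  have FB : F ((fst @^-1` B1) `&` (snd @^-1` B2)) by exact: filterI.
  by apply: (@filterS _ F _ _ _ _ FB) => z; exact: BA.
exists (a, b); split=> //.
apply: Kcl => B /Fab FB.
have /filter_ex[z [Kz Bz]] : F (K `&` B) by exact: filterI.
by exists z.
Qed.

End equivalent_metric.

(** * Tail bounds and uniform tightness of the couplings *)

Lemma probability_setI_ge (d : measure_display) (T : measurableType d)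
    (R : realType) (P : probability T R) (A B : set T) (a b : R) :
  measurable A -> measurable B -> ((1 - a)%:E <= P A)%E ->
  ((1 - b)%:E <= P B)%E -> ((1 - (a + b))%:E <= P (A `&` B))%E.
Proof.
move=> mA mB PA PB.
have mAB : measurable (A `&` B) by exact: measurableI.
have mDB : measurable (A `\` B) by exact: measurableD.
have PAE : P A = (P (A `&` B) + P (A `\` B))%E.
  by rewrite addeC -measureDI.
have PDB : (P (A `\` B) <= 1 - P B)%E.
  rewrite -probability_setC//; apply: le_measure; rewrite ?inE//.
  exact: measurableC.
have PBf := fin_num_measure P _ mB; have PABf := fin_num_measure P _ mAB.
have PDf := fin_num_measure P _ mDB.
move: PA PB PDB; rewrite PAE -(fineK PBf) -(fineK PABf) -(fineK PDf).
by rewrite -EFinB -EFinD !lee_fin; lra.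
Qed.

Lemma continuous_tail (R : realType) (T : ptopologicalType)
    (P : probability (borel T) R) (f : T -> R) (e : R) : continuous f -> 0 < e ->
  exists n : nat, ((1 - e)%:E <= P [set z | (f z <= n%:R)%R])%E.
Proof.
move=> cf e0; pose F (n : nat) := [set z | f z <= n%:R] : set (borel T).
have mF n : measurable (F n).
  by apply: measurable_borel_closed; exact: closed_le_continuous.
have FT : \bigcup_n F n = setT.
  rewrite -subTset => z _; exists (Num.bound `|f z|) => //=.
  by apply: ltW; apply: (le_lt_trans (ler_norm _)); exact: archi_boundP.
have cvF : P (F n) @[n --> \oo] --> (1 : R)%:E.
  rewrite -[1%:E](probability_setT P) -FT; apply: nondecreasing_cvg_mu => //.
    by rewrite FT.
  by move=> m n mn; apply/subsetPset => z /le_trans; apply; rewrite ler_nat.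
have [N _ NF] : \forall n \near \oo, ((1 - e)%:E < P (F n))%E.
  have e1 : ((1 - e)%:E < 1%:E)%E by rewrite lte_fin ltrBlDr ltrDl.
  exact: (cvF _ (open_ereal_gt' e1)).
by exists N; apply: ltW; exact: (NF N (leqnn N)).
Qed.

(** Markov's inequality on the set [{f > N}], applied to [min(N, f)], which is bounded and still
    equals [N] there. *)
Lemma integral_tail (R : realType) (T : ptopologicalType)
    (P : probability (borel T) R) (f : T -> R) (b e N : R) : continuous f -> (forall z, 0 <= f z) ->
  (\int[P]_z (f z)%:E <= b%:E)%E -> 0 < N -> b <= e * N ->
  ((1 - e)%:E <= P [set z | (f z <= N)%R])%E.
Proof.
move=> cf f0 fb N0 bN; pose G := [set z | N < f z] : set (borel T).
have mG : measurable G.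
  by apply: measurable_borel_open; exact: open_gt_continuous.
have bt : bcts (fun z => Num.min N (f z)) by apply: bcts_min => //; exact: ltW.
have H : (N%:E * P G <= b%:E)%E.
  apply: (@le_trans _ _ (mean (fun z => Num.min N (f z)) P)%:E).
    apply: mean_ge_measure => //; first exact: ltW.
      by move=> z; rewrite le_min f0 (ltW N0).
    by move=> z; rewrite /G/= le_min lexx => /ltW.
  apply: le_trans fb; rewrite -meanE//; apply: ge0_le_integral => //.
  - by move=> z _; rewrite lee_fin le_min f0 (ltW N0).
  - by apply/measurable_EFinP; exact: measurable_borel_continuous bt.1.
  - by apply/measurable_EFinP; exact: measurable_borel_continuous cf.
  - by move=> z _; rewrite lee_fin ge_min lexx orbT.
have -> : [set z | (f z <= N)%R] = ~` G.
  by apply/seteqP; split=> z /=; rewrite /G/= leNgt => /negP.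
rewrite probability_setC//.
have Gf := fin_num_measure P _ mG; move: H; rewrite -(fineK Gf).
rewrite -EFinM -EFinB !lee_fin => H; rewrite lerD2l lerN2.
by rewrite -(ler_pM2l N0) (le_trans H)// mulrC.
Qed.

Section couplings.
Context (R : realType) (n : nat) (hn : (0 < n)%N) (p : R) (hp : 1 <= p).
Context (Xi : 'I_n -> metricType R).
Hypothesis hXi : forall k, proper_metric_space (Xi k).
Context (xi0 : forall k, Xi k) (rho : metric R (forall k, Xi k)).
Hypothesis hrho : exists q : \bar R,
  (1 <= q)%E /\ equivalent_to_product_dist rho q.

Local Notation X := (metrized xi0 rho).

Lemma continuous_cost k :
  continuous (fun z : X * X => mdist (z.1 k) (z.2 k) `^ p).
Proof.
apply: continuous_powR; first exact: lt_le_trans hp.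
  apply: continuous_mdist => z.
    apply: (@continuous_comp _ _ _ fst (fun x : X => x k : Xi k)).
      exact: cvg_fst.
    exact: continuous_coord.
  apply: (@continuous_comp _ _ _ snd (fun x : X => x k : Xi k)).
    exact: cvg_snd.
  exact: continuous_coord.
by move=> z; exact: mdist_ge0.
Qed.

(** [K] requires the first point to lie in a ball of [Q]-mass at least [1 - e / 2] and the total
    cost [w] to be at most [N], which fails with probability at most [e / 2] by Markov's inequality.
    On [K] the second point is bounded too. Neither choice depends on the coupling. *)
Lemma couplings_tight (Q : probability (borel X) R) (eps : 'I_n -> R) (e : R) :
  0 < e -> exists K : set (X * X),
  [/\ compact K, measurable (K : set (borel (X * X)%type)) &
    forall pi : probability (borel (X * X)%type) R,
      (forall A : set (borel X), measurable A -> pi (fst @^-1` A) = Q A) ->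
      (forall k, \int[pi]_z (mdist (z.1 k) (z.2 k) `^ p)%:E
                 <= (eps k `^ p)%:E)%E ->
      ((1 - e)%:E <= pi K)%E].
Proof.
move=> e0; have e20 : 0 < e / 2 by rewrite divr_gt0.
pose a (x : X) : R := mdist (xi0 : X) x.
have ca : continuous a.
  apply: (@continuous_mdist _ X X (cst (xi0 : X)) id).
    exact: cst_continuous.
  by move=> x; exact: cvg_id.
pose w (z : X * X) : R := \sum_(k < n) mdist (z.1 k) (z.2 k) `^ p.
have cw : continuous w.
  apply: continuous_big => [|k _]; first exact: add_continuous.
  exact: continuous_cost.
have w0 z : 0 <= w z by apply: sumr_ge0 => k _; exact: powR_ge0.
have [m Qm] := continuous_tail Q ca e20.
pose E := \sum_(k < n) eps k `^ p.
have E0 : 0 <= E by apply: sumr_ge0 => k _; exact: powR_ge0.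
(* Chosen so that [E <= (e / 2) N]; the summand 1 keeps [N] positive when [E] vanishes. *)
pose N := E / (e / 2) + 1.
have N0 : 0 < N by rewrite ltr_wpDl// divr_ge0// ltW.
pose A := [set x : X | a x <= m%:R].
pose B := [set z : X * X | w z <= N].
have clA : closed A by exact: closed_le_continuous.
have clB : closed B by exact: closed_le_continuous.
have cfst : continuous (fst : X * X -> X) by move=> z; exact: cvg_fst.
have clfA : closed (fst @^-1` A : set (X * X)) by exact: preimage_closed.
have clK : closed ((fst @^-1` A : set (X * X)) `&` B) by exact: closedI.
exists ((fst @^-1` A) `&` B); split.
- have [c c0 hc] := coord_le_metric xi0 hrho.
  apply: (@bounded_closed_compact _ _ hn _ xi0 rho hrho hXi _
    (c * m%:R + (1 + N))) => //.
  move=> z [Az Bz] k.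
  have z1 : mdist (xi0 k) (z.1 k) <= c * m%:R.
    by apply: le_trans (hc xi0 z.1 k) _; rewrite ler_pM2l.
  have z2 : mdist (z.1 k) (z.2 k) <= 1 + N.
    (* A displacement greater than 1 is at most its [p]th power, as [p >= 1], hence at most
       [w z <= N]. *)
    have [t1|t1] := leP (mdist (z.1 k) (z.2 k)) 1.
      by rewrite (le_trans t1)// lerDl ltW.
    rewrite -[leLHS]powRr1 ?mdist_ge0//; apply: le_trans (ler_powR (ltW t1) hp) _.
    apply: (@le_trans _ _ (w z)).
      by rewrite /w (bigD1 k)//= lerDl; apply: sumr_ge0 => i _; exact: powR_ge0.
    by rewrite (le_trans Bz)// lerDr.
  have N1 : 0 <= 1 + N by rewrite addr_ge0// ltW.
  split; first by rewrite (le_trans z1)// lerDl.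
  by rewrite (le_trans (metric_triangle _ (z.1 k) _))// lerD.
- exact: measurable_borel_closed.
- move=> pi piQ pieps; rewrite [e]splitr; apply: probability_setI_ge.
  + exact: measurable_borel_closed.
  + exact: measurable_borel_closed.
  + by rewrite piQ//; exact: measurable_borel_closed.
  + apply: (@integral_tail _ _ _ w E (e / 2) N) => //.
      rewrite (_ : (fun z => _) = (fun z =>
        \sum_(k < n) (mdist (z.1 k) (z.2 k) `^ p)%:E)%E).
        rewrite ge0_integral_sum//.
        + by rewrite -sumEFin; apply: lee_sum.
        + move=> k; apply/measurable_EFinP; apply: measurable_borel_continuous.
          exact: continuous_cost.
        + by move=> k z _; rewrite lee_fin powR_ge0.
      by apply/funext => z; rewrite sumEFin.
    by rewrite mulrDr mulr1 mulrCA mulfV ?gt_eqF// mulr1 lerDl ltW.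
Qed.

End couplings.

(** * Weak convergence and compactness of the hyperrectangle *)

Lemma bounded_continuous_bcts (R : realType) (T : ptopologicalType)
  (g : bounded_continuous R T) : bcts (sval g).
Proof.
case: g => g [cg bg] /=; split => //.
have [M [_ /(_ (M + 1))]] := bg; rewrite ltrDl ltr01 => /(_ isT) gM.
by exists (M + 1) => z; exact: gM.
Qed.

(** Convergence in a supremum of topologies is convergence in each of them, here the initial
    topology of each mean. *)
Lemma cvg_weak_probability (R : realType) (T : ptopologicalType)
    (F : set_system (weak_probability R T)) (P : weak_probability R T) :
  Filter F -> (forall g : bounded_continuous R T,
    mean (sval g) Q @[Q --> F] --> mean (sval g) P) -> F --> P.
Proof.
move=> FF cvF; apply/cvg_sup => g A.
move=> [_ [[B oB <-] BP] BA]; apply: (@filterS _ F _ _ _ BA).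
exact: (cvF g B (open_nbhs_nbhs (conj oB BP))).
Qed.

Theorem theorem4p1 (R : realType) (n : nat) (hn : (0 < n)%N)
  (p : R) (hp : 1 <= p)
  (Xi : 'I_n -> metricType R) (hXi : forall k, proper_metric_space (Xi k))
  (xi0 : forall k, Xi k)
  (rho : metric R (forall k, Xi k))
  (hpolish : polish_space R (metrized xi0 rho))
  (hrho : exists q : \bar R, (1 <= q)%E /\ equivalent_to_product_dist rho q)
  (eps : 'I_n -> R) (heps : forall k, 0 <= eps k)
  (Q : probability (borel (metrized xi0 rho)) R) (hQ : finite_moment p Q) :
  compact (multi_transport_hyperrectangle p Q eps
             : set (weak_probability R (metrized xi0 rho))).
Proof.
set X := metrized xi0 rho; set MTH := multi_transport_hyperrectangle p Q eps.
rewrite compact_ultra => U UU UM.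
pose coupling P (pi : probability (borel (X * X)%type) R) :=
  [/\ forall A, measurable A ->
        pushforward pi (fst : borel (X * X)%type -> borel X) A = Q A,
      forall A, measurable A ->
        pushforward pi (snd : borel (X * X)%type -> borel X) A = P A &
      forall k : 'I_n,
        (\int[pi]_z (mdist (z.1 k) (z.2 k) `^ p)%:E <= (eps k `^ p)%:E)%E].
(* [U] is proper, so [MTH] has a member; its coupling [pi0] serves as the default value of the
   choice outside [MTH]. *)
have [P0 [pi0 _]] : exists P, MTH P by exact: filter_ex UM.
have /choice[pi piP] : forall P : probability (borel X) R,
    exists pi, MTH P -> coupling P pi.
  move=> P; have [[pi Ppi]|nP] := pselect (MTH P); first by exists pi.
  by exists pi0.
have cozeroXX : opens_are_cozero R (X * X)%type.
  exact: pseudometric_opens_are_cozero.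
have [|piU piUcvg] := @prokhorov_ultra R (X * X)%type _ U pi UU cozeroXX.
  move=> e e0.
  have [K [cK mK KP]] := couplings_tight hn hp hXi hrho Q eps e0.
  exists K; split => //; apply: (@filterS _ U _ _ _ _ UM) => P /piP[P1 _ P3].
  exact: KP.
have cfst : continuous (fst : X * X -> X) by move=> z; exact: cvg_fst.
have csnd : continuous (snd : X * X -> X) by move=> z; exact: cvg_snd.
have bcts_comp (phi : X * X -> X) (g : X -> R) : continuous phi -> bcts g ->
    bcts (g \o phi).
  move=> cphi [cg [M gM]]; split; last by exists M => z; exact: gM.
  by move=> z; apply: continuous_comp; [exact: cphi|exact: cg].
have [P1 P1E] := continuous_pushforward piU cfst.
have [P2 P2E] := continuous_pushforward piU csnd.
(* For [P] in [MTH] the mean of [g \o fst] under [pi P] is the constant [mean g Q], so the limit has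
   this value as well. *)
have P1Q : forall A : set (borel X), measurable A -> P1 A = Q A.
  apply: borel_probability_unique => [|g bg].
    exact: pseudometric_opens_are_cozero.
  rewrite (mean_pushforward cfst (fun A _ => P1E A) bg).
  rewrite -(cvg_lim _ (piUcvg _ (bcts_comp _ _ cfst bg)))//.
  apply/cvg_lim => //; apply: cvg_near_cst.
  apply: (@filterS _ U _ _ _ _ UM) => P /piP[PQ _ _].
  by rewrite (mean_pushforward cfst PQ bg).
exists P2; split.
  exists piU; split.
  - by move=> A mA; rewrite -P1Q// -P1E.
  - by move=> A mA; rewrite -P2E.
  (* Truncated costs are bounded and continuous, so their means under [pi P] converge along [U] to
     the mean under [piU] and keep the budget as a bound. *)
  - move=> k; apply: le_integral_truncated.
    + exact: continuous_cost.
    + by move=> z; exact: powR_ge0.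
    move=> m.
    have bm : bcts (fun z : X * X => Num.min m%:R (mdist (z.1 k) (z.2 k) `^ p)).
      by apply: bcts_min => // [|z]; [exact: continuous_cost|exact: powR_ge0].
    have cvm := piUcvg _ bm.
    rewrite -(cvg_lim _ cvm)//; apply: limr_le.
      by apply/cvg_ex; eexists; exact: cvm.
    apply: (@filterS _ U _ _ _ _ UM) => P /piP[_ _ /(_ k) Pk].
    rewrite -lee_fin -meanE//; apply: le_trans Pk; apply: ge0_le_integral => //.
    + by move=> z _; rewrite lee_fin le_min ler0n powR_ge0.
    + by apply/measurable_EFinP; exact: measurable_borel_continuous bm.1.
    + by apply/measurable_EFinP; apply: measurable_borel_continuous;
        exact: continuous_cost.
    + by move=> z _; rewrite lee_fin ge_min lexx orbT.
(* On [MTH] the mean of [g] under [P] is that of [g \o snd] under [pi P], which converges along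
   [U]. *)
apply: cvg_weak_probability => g.
have bg := bounded_continuous_bcts g.
rewrite (mean_pushforward csnd (fun A _ => P2E A) bg).
have := piUcvg _ (bcts_comp _ _ csnd bg); apply: cvg_trans.
apply: near_eq_cvg; apply: (@filterS _ U _ _ _ _ UM) => P /piP[_ PP _].
by rewrite (mean_pushforward csnd PP bg).
Qed.
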